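(* Let $X$ be a regular space and let $\kappa$ be an infinite cardinal. If $X$ is $Cl_\kappa$-Lindelöf, then $t(X_\delta) \leq 2^\kappa$.
   Context: Regular spaces are assumed to be $T_1$. For a space $X$, $X_\delta$ (the $G_\delta$-modification of $X$) is the set $X$ with the topology generated by the $G_\delta$-subsets of $X$ (the $G_\delta$-subsets of $X$ form a base). The tightness $t(Z)$ of a space $Z$ is the least infinite cardinal $\lambda$ such that whenever $A \subseteq Z$ and $p \in \overline{A}$ there is $B \subseteq A$ with $|B| \leq \lambda$ and $p \in \overline{B}$. Let $W \subseteq X$ and let $\kappa$ be an infinite cardinal. $[W]^{\leq \kappa}$ denotes the set of all subsets of $W$ of cardinality at most $\kappa$. A collection $\mathcal{U}$ of subsets of $X$ is a $Cl_\kappa$-cover of $W$ if for every $C \in [W]^{\leq \kappa}$ there is $U_C \in \mathcal{U}$ such that $\overline{C} \subseteq U_C$ (closure in $X$). It is an open $Cl_\kappa$-cover if moreover its members are open in $X$. The space $X$ is $Cl_\kappa$-Lindelöf if whenever $W$ is a subset of $X$ and $\mathcal{U}$ is an open $Cl_\kappa$-cover of $W$, then $W$ is covered by countably many elements of $\mathcal{U}$. *)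

(* Defs.v *)
From HB Require Import structures.
From mathcomp Require Import all_boot all_order all_algebra.
From mathcomp Require Import all_classical.
From mathcomp Require Import topology borel_hierarchy.

Set Implicit Arguments.
Unset Strict Implicit.
Unset Printing Implicit Defensive.

Local Open Scope classical_set_scope.
Local Open Scope card_scope.

(* Cardinals are represented by types: the cardinal of [K : Type] is that of
   [[set: K]], and 2 ^ K is the cardinal of the type [set K]. *)

Lemma GdeltaI (X : topologicalType) (A B : set X) :
  Gdelta A -> Gdelta B -> Gdelta (A `&` B).
Proof.
move=> [F oF ->] [G oG ->]; exists (fun i => F i `&` G i) => [i|].
  exact: openI.
by rewrite bigcapI.
Qed.

(* A copy of the carrier of [X], with the topology whose base consists of the
   G_delta subsets of [X]. *)
Definition Gdelta_mod (X : topologicalType) : Type := X.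

Section Gdelta_mod_topology.
Variable X : topologicalType.

HB.instance Definition _ := Choice.on (Gdelta_mod X).

Let Gdelta_cover : \bigcup_(G in @Gdelta X) G = setT.
Proof.
by apply/seteqP; split=> // x _; exists setT => //; exact/open_Gdelta/openT.
Qed.

Let Gdelta_join (G H : set X) (x : X) : Gdelta G -> Gdelta H -> G x -> H x ->
  exists K, [/\ Gdelta K, K x & K `<=` G `&` H].
Proof. by move=> ? ? ? ?; exists (G `&` H); split => //; exact: GdeltaI. Qed.

HB.instance Definition _ :=
  isBaseTopological.Build (Gdelta_mod X) Gdelta_cover Gdelta_join.

Lemma open_Gdelta_modE (A : set (Gdelta_mod X)) :
  open A <-> exists2 D : set (set X), D `<=` @Gdelta X & \bigcup_(G in D) G = A.
Proof. by []. Qed.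

End Gdelta_mod_topology.

Definition tight_at_most (Z : topologicalType) (L : Type) :=
  forall (A : set Z) (p : Z), closure A p ->
    exists B : set Z, [/\ B `<=` A, B #<= [set: L] & closure B p].

(* [L] represents t(Z), the least infinite cardinal bounding tightness. *)
Definition is_tightness (Z : topologicalType) (L : Type) :=
  [/\ infinite_set [set: L], tight_at_most Z L &
      forall M : Type, infinite_set [set: M] -> tight_at_most Z M ->
        [set: L] #<= [set: M]].

Definition Cl_cover (X : topologicalType) (K : Type) (W : set X)
    (U : set (set X)) :=
  forall C : set X, C `<=` W -> C #<= [set: K] ->
    exists2 V : set X, U V & closure C `<=` V.

Definition open_Cl_cover (X : topologicalType) (K : Type) (W : set X)
    (U : set (set X)) :=
  Cl_cover K W U /\ U `<=` open.

Definition Cl_Lindelof (X : topologicalType) (K : Type) :=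
  forall (W : set X) (U : set (set X)), open_Cl_cover K W U ->
    exists V : set (set X),
      [/\ V `<=` U, countable V & W `<=` \bigcup_(A in V) A].

(* Main.v *)
Require Import Defs.
From mathcomp Require Import all_boot all_order all_algebra.
From mathcomp Require Import all_classical.
From mathcomp Require Import topology borel_hierarchy.

Local Open Scope classical_set_scope.
Local Open Scope card_scope.

(** Let [p] be in the G_delta-closure of [A].  For every [C] with
    [p \notin closure C], regularity gives an open [V C] containing [closure C]
    with [p \notin closure (V C)].  For countably many sets [C_n] of size at most
    [K], the G_delta set of points outside every [closure (V C_n)] contains [p],
    hence meets [A]; let [F] choose a point there, and let [B] be the least set
    closed under [F], so that [B `<=` A] and [B] has size at most [2 ^ K].  If
    a G_delta set [\bigcap_n U_n] containing [p] missed [B], then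
    [B = \bigcup_n B `\` U_n], and the sets [V C] with [C `<=` B `\` U_n] of
    size at most [K] form an open Cl_K-cover of [B `\` U_n].  Countably many
    [V C_m] would then cover [B], although [F] gives a point of [B] outside all
    of them. *)

(** * Comparing cardinalities of types *)

Lemma card_leTP {T U : Type} :
  [set: T] #<= [set: U] <-> exists f : T -> U, injective f.
Proof.
split; last first.
  move=> [f fI]; have: [set: T] #<= f @` [set: T].
    by have /card_eqPle[] := inj_card_eq (A := setT) (in2W fI).
  by move=> /card_le_trans; apply; exact: card_leT.
elim/Ppointed: U => U.
  rewrite emptyE => /eqP T0.
  have F (t : T) : False by have : [set: T] t by []; rewrite T0.
  by exists (fun t => False_rect U (F t)) => t; case: (F t).
move=> /pcard_injP[f fI]; exists f => x y; apply: fI; exact: in_setT.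
Qed.

(* By maximality of a set [S] of tuples any two of which differ in every
   coordinate, some projection [S -> A i] is onto; each [S -> A j] is injective. *)
Lemma exists_least_card (I : Type) (A : I -> Type) (i0 : I) :
  exists i, forall j, [set: A i] #<= [set: A j].
Proof.
pose P (S : set (forall j, A j)) :=
  forall s t, S s -> S t -> forall j, s j = t j -> s = t.
have [F FP Ft|S [PS Smax]] := @Zorn_bigcup _ P.
  move=> s t [X FX Xs] [Y FY Yt].
  by have [XY|YX] := Ft _ _ FX FY;
    [apply: (FP _ FY) => //; exact: XY|apply: (FP _ FX) => //; exact: YX].
have [i Hi] : exists i, forall x : A i, exists2 s, S s & s i = x.
  apply: contrapT => /forallNP H.
  have {}H j : exists x : A j, forall s, S s -> s j <> x.
    have /existsNP[x Hx] := H j; exists x => s Ss sx; apply: Hx; by exists s.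
  pose x j := projT1 (cid (H j)).
  have xP j s : S s -> s j <> x j by exact: (projT2 (cid (H j))).
  apply: (Smax (S `|` [set x])).
    split=> [s Ss|]; first by left.
    by move=> /(_ x (or_intror erefl)) Sx; exact: (xP i0 x Sx).
  move=> s t [Ss|->] [St|->] j //; first exact: PS.
  - by move=> /(xP _ _ Ss).
  - by move=> /esym/(xP _ _ St).
exists i => j; apply/card_leTP.
pose g x := projT1 (cid2 (Hi x)).
have gP x : S (g x) /\ g x i = x by rewrite /g; case: cid2.
exists (fun x => g x j) => x y /(PS _ _ (gP x).1 (gP y).1) e.
by rewrite -(gP x).2 -(gP y).2 e.
Qed.

Lemma card_le_total (T U : Type) :
  [set: T] #<= [set: U] \/ [set: U] #<= [set: T].
Proof.
have [b bP] := exists_least_card bool (fun b : bool => if b then T else U) true.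
by case: b bP => bP; [left; exact: (bP false)|right; exact: (bP true)].
Qed.

(** * Squares and finite sequences over an infinite type *)

Section square.
Variable K : Type.
Variable iota : nat -> K.
Hypothesis iotaI : injective iota.

Definition dom (G : set (K * (K * K))) := [set a | exists b, G (a, b)].

(* [G] is the graph of a partial map from [dom G] to [K * K] covering
   [dom G * dom G]; such graphs are ordered by inclusion. *)
Definition square_graph (G : set (K * (K * K))) :=
  (forall a b b', G (a, b) -> G (a, b') -> b = b') /\
  (forall a b, dom G a -> dom G b -> exists c, G (c, (a, b))).

Let decode (n : nat) : nat * nat := odflt (0, 0)%N (unpickle n).

(** Placed inside the maximal graph so that [iota 0], [iota 1] and [iota 2] lie in its domain and
    can serve as tags. Numbers coding no pair decode to [(0, 0)], which is harmless: every pair is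
    still reached. *)
Definition nat_graph : set (K * (K * K)) :=
  [set (iota n, (iota (decode n).1, iota (decode n).2)) | n in [set: nat]].

Lemma square_graph_nat : square_graph nat_graph.
Proof.
split=> [a b b' [n _ [<- <-]] [m _ [/iotaI -> <-]] //|].
move=> a b [? [n _ [<- _]]] [? [m _ [<- _]]].
exists (iota (pickle (n, m))), (pickle (n, m)) => //.
by rewrite /decode pickleK.
Qed.

(** Zorn is applied to the sets whose union with [nat_graph] is a square graph, so that the empty
    chain also has a bound. *)
Lemma square_graph_max : exists G, [/\ square_graph G, nat_graph `<=` G &
  forall H, square_graph H -> G `<=` H -> H `<=` G].
Proof.
have [F FP Ft|S [PS Smax]] :=
    @Zorn_bigcup _ [set S | square_graph (nat_graph `|` S)].
  (* Both conditions on a graph start from two of its elements, which a single member of the chain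
     provides. *)
  have two s t : (nat_graph `|` \bigcup_(X in F) X) s ->
      (nat_graph `|` \bigcup_(X in F) X) t -> exists X,
      [/\ X `<=` \bigcup_(X in F) X, square_graph (nat_graph `|` X),
          (nat_graph `|` X) s & (nat_graph `|` X) t].
    move=> [Gs|[X FX Xs]] [Gt|[Y FY Yt]].
    - exists set0; rewrite setU0; split => //; exact: square_graph_nat.
    - by exists Y; split; [exact: bigcup_sup|exact: FP|left|right].
    - by exists X; split; [exact: bigcup_sup|exact: FP|right|left].
    - have [XY|YX] := Ft _ _ FX FY.
      + exists Y; split; [exact: bigcup_sup|exact: FP|right; exact: XY|by right].
      + exists X; split; [exact: bigcup_sup|exact: FP|by right|right; exact: YX].
  split=> [a b b' Ga Gb|a b [a' Ga] [b' Gb]].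
    by have [X [_ XP Xa Xb]] := two _ _ Ga Gb; exact: XP.1 Xa Xb.
  have [X [XF XP Xa Xb]] := two _ _ Ga Gb.
  have [||c Xc] := XP.2 a b; [by exists a'|by exists b'|].
  by exists c; exact: setUS Xc.
exists (nat_graph `|` S); split => // H PH SH; apply: contrapT => HS.
apply: (Smax H).
  by split=> [|HS']; [move=> s Ss; apply: SH; right|apply: HS => s /HS'; right].
rewrite /= setUidr // => s Gs; apply: SH; by left.
Qed.

Lemma pairing_exists : exists f : K * K -> K, injective f.
Proof.
have [G [[Gfun Gpair] natG Gmax]] := square_graph_max.
set D := dom G.
have Diota n : D (iota n) by eexists; apply: natG; exists n.
have m_ (a b : K) : exists c, D a -> D b -> G (c, (a, b)).
  case: (pselect (D a /\ D b)) => [[Da Db]|n].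
    by have [c ?] := Gpair a b Da Db; exists c.
  by exists a => ? ?; exfalso; apply: n.
pose m a b := projT1 (cid (m_ a b)).
have mP a b : D a -> D b -> G (m a b, (a, b)) by exact: (projT2 (cid (m_ a b))).
have mD a b : D a -> D b -> D (m a b) by move=> Da Db; eexists; exact: mP.
have mI a b a' b' : m a b = m a' b' -> D a -> D b -> D a' -> D b' ->
    a = a' /\ b = b'.
  move=> e Da Db Da' Db'; suff [-> ->] : (a, b) = (a', b') by [].
  by apply: (Gfun (m a b)); [|rewrite e]; exact: mP.
(* If [D] embeds in its complement through [J], then [J a], for [a] in [D], can
   be sent to the pairs of [D `|` J @` D] outside [D * D], contradicting
   maximality; otherwise [K] itself embeds in [D * D], hence in [D]. *)
have [] := card_le_total D (~` D).
- move=> /card_leTP[j jI].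
  pose J x := if pselect (D x) is left Dx then val (j (SigSub (mem_set Dx)))
              else x.
  have JN x : D x -> ~ D (J x).
    by rewrite /J; case: pselect => // Dx _; exact: set_mem (valP (j _)).
  have JI x y : D x -> D y -> J x = J y -> x = y.
    rewrite /J; case: pselect => // Dx _; case: pselect => // Dy _.
    by move=> /val_inj/jI[].
  (* [J a] is to be sent to the pair [v] encoded by [a]; the tags 0, 1, 2 tell which coordinates are
     moved by [J]. *)
  pose new a v x y := [\/ a = m (iota 0%N) (m x y) /\ v = (J x, y),
    a = m (iota 1%N) (m x y) /\ v = (x, J y) |
    a = m (iota 2%N) (m x y) /\ v = (J x, J y)].
  pose H : set (K * (K * K)) := G `|` [set p | exists a x y,
    [/\ D a, D x, D y, p.1 = J a & new a p.2 x y]].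
  have newU a v x y v' x' y' : D x -> D y -> D x' -> D y' ->
      new a v x y -> new a v' x' y' -> v = v'.
    move=> Dx Dy Dx' Dy'.
    have codeI n n' : m (iota n) (m x y) = m (iota n') (m x' y') ->
        [/\ n = n', x = x' & y = y'].
      by move=> /mI[] //; [exact: mD..|move=> /iotaI -> /mI[] // -> ->].
    by case=> -[-> ->] [] [/codeI[+ + +] ->] => // _ -> ->.
  have domH a : dom H a -> D a \/ exists2 b, D b & a = J b.
    move=> [b [Gb|[c [x [y [Dc _ _ /= -> _]]]]]]; first by left; exists b.
    by right; exists c.
  have HJ c v x y : D c -> D x -> D y -> new c v x y -> exists d, H (d, v).
    by move=> Dc Dx Dy n; exists (J c); right; exists c, x, y.
  have PH : square_graph H.
    split=> [a b b' [Gb|[c [x [y [Dc Dx Dy /= -> n]]]]]|a b /domH + /domH].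
    - move=> [Gb'|[c [x [y [Dc _ _ /= e _]]]]]; first exact: Gfun Gb Gb'.
      by case: (JN c Dc); rewrite -e; exists b.
    - move=> [Gb'|[c' [x' [y' [Dc' Dx' Dy' /= /JI e n']]]]].
        by case: (JN c Dc); exists b'.
      by rewrite -e // in n'; exact: newU n n'.
    - move=> [Da|[x Dx ->]] [Db|[y Dy ->]].
      + by exists (m a b); left; exact: mP.
      + apply: (HJ (m (iota 1%N) (m a y)) _ a y) => //.
          by apply: (mD) => //; exact: mD.
        by apply: Or32.
      + apply: (HJ (m (iota 0%N) (m x b)) _ x b) => //.
          by apply: (mD) => //; exact: mD.
        by apply: Or31.
      + apply: (HJ (m (iota 2%N) (m x y)) _ x y) => //.
          by apply: (mD) => //; exact: mD.
        by apply: Or33.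
  have GH : G `<=` H by move=> ?; left.
  have i0 := Diota 0%N.
  (* The code of [(J (iota 0), iota 0)]: maximality would put [J a] in [D]. *)
  pose a := m (iota 0%N) (m (iota 0%N) (iota 0%N)).
  have Da : D a by apply: (mD) => //; exact: mD.
  case: (JN a Da); exists (J (iota 0%N), iota 0%N).
  apply: (Gmax H PH GH); right; exists a, (iota 0%N), (iota 0%N).
  by split=> //; apply: Or31.
- move=> /card_leTP[i iI].
  have iD (x : (~` D : set K)) : D (val (i x)) by exact: set_mem (valP (i x)).
  (* Tag 1 marks points brought into [D] by [i], tag 0 those already there, so [k] embeds [K] in
     [D]. *)
  pose k x := if pselect (D x) is right n
    then m (val (i (SigSub (mem_set (n : (~` D) x))))) (iota 1%N)
    else m x (iota 0%N).
  have kD x : D (k x) by rewrite /k; case: pselect => ?; exact: mD.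
  have kI : injective k.
    move=> x y; rewrite /k.
    case: pselect => Dx; case: pselect => Dy /mI[];
    by [|exact: iD|exact: Diota|move=> _ /iotaI|move=> /val_inj/iI[]].
  exists (fun p => m (k p.1) (k p.2)) => -[x y] [x' y'] /=.
  by move=> /mI[] // => /kI -> /kI ->.
Qed.
End square.

Lemma card_square {K : Type} :
  infinite_set [set: K] -> [set: K * K] #<= [set: K].
Proof.
move=> /infiniteP/card_leTP[iota iotaI]; apply/card_leTP.
exact: pairing_exists iotaI.
Qed.

Lemma card_seq {K : Type} :
  infinite_set [set: K] -> [set: seq K] #<= [set: K].
Proof.
move=> Kinf; have /card_leTP[f fI] := card_square Kinf.
have /infiniteP/card_leTP[iota iotaI] := Kinf.
(* The leading tag separates the empty sequence from the others. *)
pose code := foldr (fun x y => f (f (iota 1%N, iota 1%N), f (x, y)))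
  (f (f (iota 0%N, iota 0%N), iota 0%N)).
apply/card_leTP; exists code.
elim=> [|x s IH] [|y t] //= /fI[].
- by move=> /fI[/iotaI].
- by move=> /fI[/iotaI].
- by move=> /fI[-> /IH ->].
Qed.

(** * Power sets, and sets closed under an infinitary operation *)

Lemma card_le_powerset {T U : Type} :
  [set: T] #<= [set: U] -> [set: set T] #<= [set: set U].
Proof.
move=> /card_leTP[f fI]; apply/card_leTP; exists (fun A => f @` A) => A B e.
by apply/funext => x; rewrite -(image_inj fI) e image_inj.
Qed.

Inductive tree (I : Type) := Leaf | Node of I -> tree I.
Arguments Leaf {I}.
Arguments Node {I}.

(* The set of paths from the root to the nodes. *)
Fixpoint tree_code {I : Type} (t : tree I) : set (seq I) :=
  if t is Node f then
    fun s => if s is i :: s' then tree_code (f i) s' else True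
  else set0.

(** The empty path tells a node from a leaf, and the paths starting with [i] recover the subtree at
    [i]. *)
Lemma tree_code_inj {I : Type} : injective (@tree_code I).
Proof.
elim=> [|f IH] [|g] //= e.
- by have : set0 (@nil I) by rewrite e.
- by have : set0 (@nil I) by rewrite -e.
- congr Node; apply/funext => i; apply: IH; apply/funext => s.
  exact: (congr1 (@^~ (i :: s)) e).
Qed.

(* [B] is the set of values of well-founded trees labelled by [F], which avoids a
   transfinite iteration.  Arguments in [option X] encode partial families, so
   that the empty family already yields an element of [B]. *)
Lemma closed_set_card (I X : Type) (F : (I -> option X) -> X) :
  exists B : set X, [/\ B `<=` range F, B #<= [set: set (seq I)] &
    forall f, (forall i x, f i = Some x -> B x) -> B (F f)].
Proof.
pose eval := fix eval (t : tree I) : option X :=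
  if t is Node f then Some (F (fun i => eval (f i))) else None.
exists [set x | exists t, eval t = Some x]; split.
- by move=> x [[|f] //= [<-]]; eexists.
- rewrite -(card_le_eql (card_setT _)).
  pose g (x : [set x | exists t, eval t = Some x]) :=
    projT1 (cid (set_mem (valP x))).
  have gP x : eval (g x) = Some (val x) by rewrite /g; case: cid.
  apply/card_leTP; exists (fun x => tree_code (g x)) => x y /tree_code_inj e.
  by apply/val_inj; have := gP x; rewrite e gP => -[].
- move=> f fB.
  have /choice[t tf] i : exists t, eval t = f i.
    case e : (f i) => [x|]; last by exists Leaf.
    by have [t] := fB i x e; exists t.
  by exists (Node t) => /=; congr (Some (F _)); apply/funext.
Qed.

(** * Tightness as a least cardinal *)

Lemma tight_at_most_le {Z : topologicalType} {L M : Type} :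
  [set: L] #<= [set: M] -> tight_at_most Z L -> tight_at_most Z M.
Proof.
move=> LM tL A p /tL[B [BA BL Bp]].
by exists B; split => //; exact: card_le_trans LM.
Qed.

(** The minimum is taken over the infinite subsets of [M] that bound the tightness. A candidate [N]
    below [M] is copied onto such a subset; one above [M] is above the minimum. *)
Lemma tightness_exists (Z : topologicalType) (M : Type) :
  infinite_set [set: M] -> tight_at_most Z M ->
  exists2 L : Type, is_tightness Z L & [set: L] #<= [set: M].
Proof.
move=> Minf tM.
pose I := {S : set M | infinite_set [set: S] /\ tight_at_most Z S}.
have [TM MT] : [set: set_type [set: M]] #<= [set: M] /\
    [set: M] #<= [set: set_type [set: M]] by exact/card_eqPle/card_setT.
have inf (S T : Type) : [set: S] #<= [set: T] -> infinite_set [set: S] ->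
    infinite_set [set: T].
  by move=> ST Sinf Tfin; apply: Sinf; exact: card_le_finite ST Tfin.
have i0 : I.
  by exists [set: M]; split; [exact: inf MT Minf|exact: tight_at_most_le MT tM].
have [i imin] := exists_least_card I (fun i => projT1 i) i0.
have LM : [set: set_type (projT1 i)] #<= [set: M].
  by rewrite (card_le_eql (card_setT _)); exact: card_leT.
exists (projT1 i) => //; split=> [||N Ninf tN]; [exact: (projT2 i).1|exact: (projT2 i).2|].
have [/card_leTP[f fI]|] := card_le_total N M; last exact: card_le_trans.
have [RN NR] : [set: set_type (range f)] #<= [set: N] /\
    [set: N] #<= [set: set_type (range f)].
  apply/card_eqPle; rewrite (card_eql (card_setT _)).
  exact: inj_card_eq (in2W fI).
have H : infinite_set [set: set_type (range f)] /\ tight_at_most Z (range f).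
  by split; [exact: inf NR Ninf|exact: tight_at_most_le NR tN].
exact: card_le_trans (imin (exist _ (range f) H)) RN.
Qed.

(** * Separation, G_delta-closure and the tightness bound *)

Lemma regular_separation {X : topologicalType} (p : X) (C : set X) :
  regular_space X -> ~ closure C p ->
  exists V, [/\ open V, closure C `<=` V & ~ closure V p].
Proof.
move=> Xreg nCp; have [|N Np NC] := Xreg p (~` closure C).
  by apply: open_nbhs_nbhs; split=> //; exact/closed_openC/closed_closure.
exists (~` closure N); split.
- exact/closed_openC/closed_closure.
- by move=> x Cx /NC.
- by move=> /(_ N Np)[x [nNx Nx]]; apply: nNx; exact: subset_closure.
Qed.

Lemma closure_Gdelta_mod {X : topologicalType} (A : set X) (p : X) :
  closure (A : set (Gdelta_mod X)) p <->
  forall G, Gdelta G -> G p -> A `&` G !=set0.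
Proof.
split=> [Ap G GG Gp|H N].
  apply: Ap; apply: open_nbhs_nbhs; split=> //.
  by apply/open_Gdelta_modE; exists [set G] => [_ -> //|]; rewrite bigcup_set1.
rewrite nbhsE => -[U [/open_Gdelta_modE[D DG <-] [G DGG Gp]] UN].
have [x [Ax Gx]] := H G (DG _ DGG) Gp.
by exists x; split=> //; apply: UN; exists G.
Qed.

(** Puts small sets, the empty one included, in the form of the partial families that
    [closed_set_card] takes as arguments. *)
Lemma option_enum {X K : Type} (D : set X) :
  D #<= [set: K] ->
  exists c : K -> option X, D = [set x | exists k, c k = Some x].
Proof.
rewrite -(card_le_eql (card_setT _)) => /card_leTP[g gI].
have /choice[c cP] k : exists o : option X,
    forall x, o = Some x <-> exists2 y : D, g y = k & val y = x.
  have [[y gy]|ny] := pselect (exists y, g y = k).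
    exists (Some (val y)) => x; split=> [[<-]|[y' + <-]]; first by exists y.
    by rewrite -gy => /gI ->.
  by exists None => x; split=> // -[y gy]; case: ny; exists y.
exists c; apply/seteqP; split=> x.
  by move=> Dx; exists (g (SigSub (mem_set Dx))); apply/cP; eexists.
by move=> [k /cP[y _ <-]]; exact: set_mem (valP y).
Qed.

Lemma Cl_Lindelof_tight (X : topologicalType) (K : Type) :
  regular_space X -> infinite_set [set: K] -> Cl_Lindelof X K ->
  tight_at_most (Gdelta_mod X) (set K).
Proof.
move=> Xreg Kinf XL A p /closure_Gdelta_mod Ap.
(* The value [set0] when [p] lies in [closure C] keeps [~ closure V p] unconditional, so that [F]
   can be defined on all families. *)
have /choice[V VP] (C : set X) : exists V : set X,
    [/\ open V, ~ closure V p & ~ closure C p -> closure C `<=` V].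
  have [Cp|/(regular_separation _ _ Xreg)[V [oV CV nVp]]] := pselect (closure C p).
    by exists set0; split=> //; [exact: open0|rewrite closure0].
  by exists V.
(* One family [f] codes countably many sets of size at most [K]. *)
pose C (f : nat * K -> option X) n := [set x | exists k, f (n, k) = Some x].
have /choice[F FP] f : exists a, A a /\ forall n, ~ closure (V (C f n)) a.
  have [||a [Aa aV]] := Ap (\bigcap_n ~` closure (V (C f n))).
  - exists (fun n => ~` closure (V (C f n))) => // n.
    exact/closed_openC/closed_closure.
  - by move=> n _ /=; have [] := VP (C f n).
  - by exists a; split=> // n; exact: aV.
have [B [BF BK Bclosed]] := closed_set_card (nat * K) X F.
exists B; split.
- by move=> _ /BF[f _ <-]; have [] := FP f.
- apply: card_le_trans BK _; apply: card_le_powerset.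
  have natK : [set: nat * K] #<= [set: K].
    apply: card_le_trans (card_square Kinf).
    have /infiniteP/card_leTP[iota iotaI] := Kinf; apply/card_leTP.
    by exists (fun z => (iota z.1, z.2)) => -[n x] [m y] [/iotaI -> ->].
  apply: card_le_trans natK; apply: card_seq.
  have [k0 _] := infinite_setN0 Kinf.
  by apply/infiniteP/card_leTP; exists (fun n => (n, k0)) => m n [].
apply/closure_Gdelta_mod => _ [U oU ->] Up; apply: contrapT => BU.
have /choice[W WP] n : exists W : set (set X),
    [/\ W `<=` [set V D | D in [set D | D `<=` B /\ D #<= [set: K]]],
        countable W & B `\` U n `<=` \bigcup_(G in W) G].
  have [|W [WU Wc BW]] := XL (B `\` U n)
    [set V D | D in [set D | D `<=` B `\` U n /\ D #<= [set: K]]].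
    split=> [D DB DK|_ [D _ <-]]; last by have [] := VP D.
    exists (V D); first by exists D.
    have [_ _] := VP D; apply.
    (* [U n] is a neighbourhood of [p] disjoint from [D]. *)
    move=> /(_ (U n))[|x [/DB[_ nUx] Ux]]; last exact: nUx.
    by apply: open_nbhs_nbhs; split=> //; exact: Up.
  exists W; split=> // _ /WU[D [DB DK] <-]; exists D => //; split=> //.
  exact: subset_trans DB (@subDsetl _ _ _).
have /countable_injP[r rI] : countable (\bigcup_n W n).
  by apply: bigcup_countable => // n _; have [] := WP n.
(* Each chosen [G] is [V] of the set enumerated by [c (r G)]; indices that number no [G] get the
   empty family. *)
have /choice[c cP] n : exists c : K -> option X,
    (forall k x, c k = Some x -> B x) /\
    forall G, (\bigcup_n W n) G -> r G = n ->
      G = V [set x | exists k, c k = Some x].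
  have [[G [WG rG]]|nG] := pselect (exists G, (\bigcup_n W n) G /\ r G = n).
    have [m _ WmG] := WG; have [/(_ _ WmG)[D [DB /option_enum[c cD]] VD] _ _] := WP m.
    exists c; split=> [k x ckx|G' WG' rG'].
      by apply: DB; rewrite cD; exists k.
    by rewrite -cD VD; apply: rI; rewrite ?inE // rG rG'.
  by exists (fun=> None); split=> // G WG rG; case: nG; exists G.
pose f (z : nat * K) := c z.1 z.2.
have [_ fV] := FP f.
have Bb : B (F f) by apply: Bclosed => -[n k] x /(cP n).1.
have [n nU] : exists n, ~ U n (F f).
  by apply/existsNP => UF; apply: BU; exists (F f); split=> // n _; exact: UF.
have [_ _ /(_ (F f))[//|G WG GF]] := WP n.
apply: (fV (r G)); apply: subset_closure.
by rewrite -((cP (r G)).2 G) //; exists n.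
Qed.

Theorem theorem3 (X : topologicalType) (K : Type) :
  accessible_space X -> regular_space X ->
  infinite_set [set: K] ->
  Cl_Lindelof X K ->
  exists2 L : Type, is_tightness (Gdelta_mod X) L & [set: L] #<= [set: set K].
Proof.
move=> _ Xreg Kinf XL; apply: tightness_exists.
  have /infiniteP/card_leTP[iota iotaI] := Kinf; apply/infiniteP/card_leTP.
  by exists (fun n => [set iota n]) => m n /seteqP[/(_ _ erefl)/iotaI].
exact: Cl_Lindelof_tight.
Qed.
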